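(* Let $A$ and $B$ be Archimedean $f$-algebras with unit elements $e_A$ and $e_B$ respectively. Then the canonical multiplication on the algebraic tensor product $A\otimes B$ can be extended to a multiplication on the Riesz tensor product $A\overline{\otimes}B$ such that $A\overline{\otimes}B$ is an $f$-algebra with unit. Moreover, $A\overline{\otimes}B$ satisfies the following multiplicative universal property: for every Archimedean $f$-algebra $C$ and every multiplicative Riesz bimorphism $\psi:A\times B\to C$, there exists a unique map $\psi^{\otimes}:A\overline{\otimes}B\to C$ which is both an algebra homomorphism and a Riesz homomorphism and satisfies $$\psi^{\otimes}(f\otimes g)=\psi(f,g)\quad\text{for all } f\in A,\ g\in B .$$
   Context: A Riesz space is a real vector lattice. A lattice-ordered algebra is a Riesz space with an associative bilinear multiplication for which products of positive elements are positive; it is an $f$-algebra if $f\wedge g=0$ and $h\ge 0$ imply $fh\wedge g=hf\wedge g=0$. A Riesz homomorphism is a linear map $T$ with $T(|x|)=|T(x)|$. A bilinear map $\varphi:E\times F\to G$ between Riesz spaces is a Riesz bimorphism if $\varphi(\cdot,y)$ and $\varphi(x,\cdot)$ are Riesz homomorphisms for all $x\in E^{+}$, $y\in F^{+}$. A bilinear map $\psi:A\times B\to C$ between algebras is multiplicative if $\psi(aa',bb')=\psi(a,b)\psi(a',b')$ for all $a,a'\in A$, $b,b'\in B$. Algebra homomorphisms are linear multiplicative maps (not required to preserve units). Riesz (Fremlin) tensor product: for Archimedean Riesz spaces $E,F$, $E\overline{\otimes}F$ is the (essentially unique) Archimedean Riesz space with a Riesz bimorphism $\otimes:E\times F\to E\overline{\otimes}F$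 such that for every Archimedean Riesz space $G$ and every Riesz bimorphism $\varphi:E\times F\to G$ there is a unique Riesz homomorphism $\varphi^{\otimes}:E\overline{\otimes}F\to G$ with $\varphi^{\otimes}(x\otimes y)=\varphi(x,y)$. The algebraic tensor product $E\otimes F$ is identified with the linear span of $\{x\otimes y\}$ in $E\overline{\otimes}F$, and $E\overline{\otimes}F$ is the Riesz subspace generated by $E\otimes F$. The canonical multiplication on $A\otimes B$ is the bilinear one determined by $(a\otimes b)\cdot(a'\otimes b')=aa'\otimes bb'$. *)

(* Defs.v *)
From HB Require Import structures.
From mathcomp Require Import all_boot all_order all_algebra.
From mathcomp Require Import reals.

Set Implicit Arguments.
Unset Strict Implicit.
Unset Printing Implicit Defensive.

Import Order.TTheory GRing.Theory Num.Theory.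

Local Open Scope ring_scope.

(* The lattice operations are fields here, characterized as least upper and
   greatest lower bounds, because Hierarchy-Builder rejects a structure that
   inherits from both lmodType and latticeType: realDomainType already
   inherits from zmodType and latticeType, with no declared join of the two. *)
HB.mixin Record isRiesz (R : realType) E
    of GRing.Lmodule R E & Num.POrderedZmodule E := {
  rjoin : E -> E -> E ;
  rmeet : E -> E -> E ;
  rleUx : forall x y z : E, (rjoin x y <= z) = (x <= z) && (y <= z) ;
  rlexI : forall x y z : E, (z <= rmeet x y) = (z <= x) && (z <= y) ;
  rleD2r : forall x y z : E, x <= y -> x + z <= y + z ;
  rscale_ge0 : forall (a : R) (x : E), 0 <= a -> 0 <= x -> 0 <= a *: x
}.

#[short(type="rieszType")]
HB.structure Definition Riesz (R : realType) :=
  { E of GRing.Lmodule R E & Num.POrderedZmodule E & isRiesz R E }.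

Section RieszSpaces.
Variable R : realType.
Implicit Types E F G : rieszType R.

Definition rabs E (x : E) : E := rjoin x (- x).

Definition archimedean E : Prop :=
  forall x y : E, 0 <= x -> 0 <= y -> (forall n : nat, x *+ n <= y) -> x = 0.

Definition riesz_hom E F (T : E -> F) : Prop :=
  linear T /\ (forall x, T (rabs x) = rabs (T x)).

Definition bilinear_map E F G (phi : E -> F -> G) : Prop :=
  (forall y, linear (phi^~ y)) /\ (forall x, linear (phi x)).

Definition riesz_bimorphism E F G (phi : E -> F -> G) : Prop :=
  [/\ bilinear_map phi,
      forall y, 0 <= y -> riesz_hom (phi^~ y)
    & forall x, 0 <= x -> riesz_hom (phi x)].

(* (T, tens) is the Riesz (Fremlin) tensor product of E and F. *)
Definition riesz_tensor_product E F (T : rieszType R) (tens : E -> F -> T)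
    : Prop :=
  [/\ archimedean T,
      riesz_bimorphism tens
    & forall G : rieszType R, archimedean G ->
      forall phi : E -> F -> G, riesz_bimorphism phi ->
      exists! h : T -> G,
        riesz_hom h /\ (forall x y, h (tens x y) = phi x y)].

(* Multiplications are kept apart from the structure: f-algebras need not have
   a unit, and a given Riesz space may have to be endowed with one. *)
Definition lattice_ordered_algebra E (mul : E -> E -> E) : Prop :=
  [/\ bilinear_map mul,
      associative mul
    & forall x y, 0 <= x -> 0 <= y -> 0 <= mul x y].

Definition f_algebra E (mul : E -> E -> E) : Prop :=
  lattice_ordered_algebra mul /\
  (forall f g h : E, rmeet f g = 0 -> 0 <= h ->
     rmeet (mul f h) g = 0 /\ rmeet (mul h f) g = 0).

Definition multiplicative_bilinear E F G
    (mulE : E -> E -> E) (mulF : F -> F -> F) (mulG : G -> G -> G)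
    (psi : E -> F -> G) : Prop :=
  forall a a' b b',
    psi (mulE a a') (mulF b b') = mulG (psi a b) (psi a' b').

Definition algebra_hom E F (mulE : E -> E -> E) (mulF : F -> F -> F)
    (h : E -> F) : Prop :=
  linear h /\ {morph h : x y / mulE x y >-> mulF x y}.

(* The algebraic tensor product of E and F is the linear span of the tens x y.
   As scalars can be moved into the first factor, its elements are exactly the
   finite sums of such tensors. *)
Definition tensor_sum E F (T : rieszType R) (tens : E -> F -> T)
    (s : seq (E * F)) : T :=
  \sum_(p <- s) tens p.1 p.2.

Definition extends_canonical_mul E F (T : rieszType R) (tens : E -> F -> T)
    (mulE : E -> E -> E) (mulF : F -> F -> F) (mul : T -> T -> T) : Prop :=
  forall s t : seq (E * F),
    mul (tensor_sum tens s) (tensor_sum tens t) =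
    \sum_(p <- s) \sum_(q <- t) tens (mulE p.1 q.1) (mulF p.2 q.2).

End RieszSpaces.

(* Main.v *)
(** Meyer's theorem for order bounded disjointness preserving operators
    [f : E -> F] says that [|f a|] is additive in [a >= 0], so that an ideal of
    such operators which is closed under addition is again an Archimedean Riesz
    space. The universal property of the tensor product [T] is applied to two
    spaces of this kind. Operators [A -> T] dominated by
    [a |-> (a x) (x) y] give an action of [A] on [T], additive in [A], with
    [a . (x (x) y) = (a x) (x) y]; likewise for [B]. From
    [n a <= n^2 e + a^2] and the Archimedean property, positive elements of [A]
    and [B] act by orthomorphisms of [T]. Then [(a, b) |-> a . b . _] is a Riesz
    bimorphism into the orthomorphisms of [T], and the Riesz homomorphism [L]
    it induces yields the product [u v = L u v]. Identities between Riesz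
    bimorphisms on [T], such as associativity and multiplicativity of
    [psi^(x)], hold as soon as they hold on elementary tensors. *)

Require Import Defs.
From HB Require Import structures.
From mathcomp Require Import all_boot all_order all_algebra.
From mathcomp Require Import boolp reals.

Set Implicit Arguments.
Unset Strict Implicit.
Unset Printing Implicit Defensive.

Import Order.TTheory GRing.Theory Num.Theory.

Local Open Scope ring_scope.

(** * Order and lattice calculus in Riesz spaces *)

Section RieszTheory.
Variables (R : realType) (E : rieszType R).
Implicit Types (x y z t p q r : E) (a c : R).

Lemma riesz_leD2r z x y : (x + z <= y + z) = (x <= y).
Proof.
apply/idP/idP => [h|/rleD2r]; last exact.
by have := rleD2r _ _ (- z) h; rewrite !addrK.
Qed.

Lemma riesz_leD2l z x y : (z + x <= z + y) = (x <= y).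
Proof. by rewrite ![z + _]addrC riesz_leD2r. Qed.

Lemma riesz_leD x y z t : x <= y -> z <= t -> x + z <= y + t.
Proof.
move=> xy zt; apply: (@le_trans _ _ (y + z)); first by rewrite riesz_leD2r.
by rewrite riesz_leD2l.
Qed.

Lemma riesz_leBlDr x y z : (x - y <= z) = (x <= z + y).
Proof. by rewrite -(riesz_leD2r y (x - y)) subrK. Qed.

Lemma riesz_leBrDr x y z : (z <= x - y) = (z + y <= x).
Proof. by rewrite -(riesz_leD2r y z) subrK. Qed.

Lemma riesz_subr_ge0 x y : (0 <= y - x) = (x <= y).
Proof. by rewrite riesz_leBrDr add0r. Qed.

Lemma riesz_leN2 x y : (- x <= - y) = (y <= x).
Proof. by rewrite -[LHS]riesz_subr_ge0 opprK addrC riesz_subr_ge0. Qed.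

Lemma riesz_oppr_le0 x : (- x <= 0) = (0 <= x).
Proof. by rewrite -{1}oppr0 riesz_leN2. Qed.

Lemma riesz_addr_ge0 x y : 0 <= x -> 0 <= y -> 0 <= x + y.
Proof. by move=> x0 y0; rewrite -[0]addr0; apply: riesz_leD. Qed.

Lemma riesz_lerDl x y : (x <= x + y) = (0 <= y).
Proof. by rewrite -{1}[x]addr0 riesz_leD2l. Qed.

Lemma riesz_mulrn_ge0 n x : 0 <= x -> 0 <= x *+ n.
Proof.
by move=> x0; elim: n => [//|n IH]; rewrite mulrS riesz_addr_ge0.
Qed.

Lemma riesz_mulrn_le n x y : x <= y -> x *+ n <= y *+ n.
Proof.
by move=> xy; elim: n => [//|n IH]; rewrite !mulrS riesz_leD.
Qed.

Lemma riesz_scale_le a x y : 0 <= a -> x <= y -> a *: x <= a *: y.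
Proof.
move=> a0 xy; rewrite -riesz_subr_ge0 -scalerBr.
by apply: rscale_ge0 => //; rewrite riesz_subr_ge0.
Qed.

Lemma riesz_scale_lel a c x : a <= c -> 0 <= x -> a *: x <= c *: x.
Proof.
move=> ac x0; rewrite -riesz_subr_ge0 -scalerBl.
by apply: rscale_ge0; rewrite ?subr_ge0.
Qed.

Lemma riesz_halfK x : (2%:R : R)^-1 *: (x *+ 2) = x.
Proof. by rewrite -scaler_nat scalerA mulVf ?pnatr_eq0 // scale1r. Qed.

Lemma riesz_mulr2n_inj x y : x *+ 2 = y *+ 2 -> x = y.
Proof. by move=> h; rewrite -(riesz_halfK x) h riesz_halfK. Qed.

Lemma riesz_mulr2n_ge0 x : 0 <= x *+ 2 -> 0 <= x.
Proof.
by move=> h; rewrite -(riesz_halfK x) rscale_ge0 // invr_ge0 ler0n.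
Qed.

Lemma rle_joinl x y : x <= rjoin x y.
Proof. by have := lexx (rjoin x y); rewrite rleUx => /andP[]. Qed.

Lemma rle_joinr x y : y <= rjoin x y.
Proof. by have := lexx (rjoin x y); rewrite rleUx => /andP[]. Qed.

Lemma rjoin_le x y z : x <= z -> y <= z -> rjoin x y <= z.
Proof. by move=> xz yz; rewrite rleUx xz yz. Qed.

Lemma rmeet_lel x y : rmeet x y <= x.
Proof. by have := lexx (rmeet x y); rewrite rlexI => /andP[]. Qed.

Lemma rmeet_ler x y : rmeet x y <= y.
Proof. by have := lexx (rmeet x y); rewrite rlexI => /andP[]. Qed.

Lemma rle_meet x y z : z <= x -> z <= y -> z <= rmeet x y.
Proof. by move=> xz yz; rewrite rlexI xz yz. Qed.

Lemma rmeetC x y : rmeet x y = rmeet y x.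
Proof.
by apply/le_anti/andP; split; apply: rle_meet;
  rewrite ?rmeet_lel ?rmeet_ler.
Qed.

Lemma rjoinC x y : rjoin x y = rjoin y x.
Proof.
by apply/le_anti/andP; split; apply: rjoin_le;
  rewrite ?rle_joinl ?rle_joinr.
Qed.

Lemma rmeet_mono x y z t : x <= z -> y <= t -> rmeet x y <= rmeet z t.
Proof.
move=> xz yt; apply: rle_meet.
- exact: le_trans (rmeet_lel _ _) xz.
- exact: le_trans (rmeet_ler _ _) yt.
Qed.

Lemma rjoinD x y z : rjoin x y + z = rjoin (x + z) (y + z).
Proof.
apply/le_anti/andP; split; last first.
  by apply: rjoin_le; rewrite riesz_leD2r ?rle_joinl ?rle_joinr.
rewrite -riesz_leBrDr; apply: rjoin_le; rewrite riesz_leBrDr.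
- exact: rle_joinl.
- exact: rle_joinr.
Qed.

Lemma rjoinN x y : - rjoin x y = rmeet (- x) (- y).
Proof.
apply/le_anti/andP; split.
  by apply: rle_meet; rewrite riesz_leN2 ?rle_joinl ?rle_joinr.
rewrite -riesz_leN2 opprK; apply: rjoin_le; rewrite -riesz_leN2 opprK.
- exact: rmeet_lel.
- exact: rmeet_ler.
Qed.

Lemma rmeetD x y z : rmeet x y + z = rmeet (x + z) (y + z).
Proof.
apply/le_anti/andP; split.
  by apply: rle_meet; rewrite riesz_leD2r ?rmeet_lel ?rmeet_ler.
rewrite -riesz_leBlDr; apply: rle_meet; rewrite riesz_leBlDr.
- exact: rmeet_lel.
- exact: rmeet_ler.
Qed.

(** Adding [x + y] to the join of [- x] and [- y] gives [rjoin x y], while that join is also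
    [- rmeet x y]. *)
Lemma rjoin_add_meet x y : rjoin x y + rmeet x y = x + y.
Proof.
have e : rjoin (- x) (- y) + (x + y) = rjoin x y.
  by rewrite rjoinD addrA addNr add0r addrCA addNr addr0 rjoinC.
have -> : rmeet x y = - rjoin (- x) (- y) by rewrite rjoinN !opprK.
by rewrite -e addrAC subrr add0r.
Qed.

(** This is the nontrivial half of distributivity. The map [u |-> rmeet u z - u] is decreasing, so
    every [u] below [j = rjoin x y] with [rmeet u z <= w] satisfies [u <= w - m + j]. Applying this
    to [x] and [y] bounds their join [j], and [m <= w] follows. *)
Lemma rmeetUl x y z : rmeet (rjoin x y) z <= rjoin (rmeet x z) (rmeet y z).
Proof.
have step u v : u <= v ->
    rmeet v z - v <= rmeet u z - u.
  move=> uv; rewrite !rmeetD !subrr; apply: rle_meet; first exact: rmeet_lel.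
  apply: le_trans (rmeet_ler _ _) _.
  by rewrite riesz_leD2l riesz_leN2.
set w := rjoin (rmeet x z) _; set m := rmeet _ z; set j := rjoin x y.
have key u : u <= j -> rmeet u z <= w -> u <= w - m + j.
  move=> uj uw; have := step _ _ uj; rewrite -/m riesz_leBrDr => h.
  rewrite -addrA -[- m + j]opprK opprD opprK riesz_leBrDr addrC.
  exact: le_trans h uw.
have : j <= w - m + j.
  apply: rjoin_le; apply: key; rewrite ?rle_joinl ?rle_joinr //.
by rewrite addrC riesz_lerDl riesz_subr_ge0.
Qed.

(** The negative part of [x] is written [rpos (- x)] throughout. *)
Definition rpos x := rjoin x 0.

Lemma rpos_ge0 x : 0 <= rpos x. Proof. exact: rle_joinr. Qed.

Lemma rpos_id x : 0 <= x -> rpos x = x.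
Proof. by move=> x0; apply/le_anti; rewrite rle_joinl rjoin_le. Qed.

Lemma rpos_eq0 x : x <= 0 -> rpos x = 0.
Proof. by move=> x0; apply/le_anti; rewrite rle_joinr rjoin_le. Qed.

Lemma rposBneg x : rpos x - rpos (- x) = x.
Proof.
have -> : rpos x = rpos (- x) + x by rewrite /rpos rjoinD addNr add0r rjoinC.
by rewrite addrAC subrr add0r.
Qed.

Lemma rpos_meet_neg x : rmeet (rpos x) (rpos (- x)) = 0.
Proof.
have e : rpos x = x + rpos (- x) by rewrite -{2}(rposBneg x) subrK.
have m : rmeet x 0 = - rpos (- x) by rewrite rjoinN opprK oppr0.
by rewrite e -[X in rmeet _ X]add0r -rmeetD m addNr.
Qed.

Lemma rle_abs x : x <= rabs x. Proof. exact: rle_joinl. Qed.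

Lemma rleN_abs x : - x <= rabs x. Proof. exact: rle_joinr. Qed.

Lemma rabs_ge0 x : 0 <= rabs x.
Proof.
apply: riesz_mulr2n_ge0; rewrite mulr2n -(subrr x).
by apply: riesz_leD; [exact: rle_abs|exact: rleN_abs].
Qed.

Lemma rabsE x : rabs x = rpos x + rpos (- x).
Proof.
apply/le_anti/andP; split.
  apply: rjoin_le.
    by rewrite -[x in X in X <= _]addr0 riesz_leD ?rle_joinl ?rpos_ge0.
  by rewrite -[- x in X in X <= _]add0r riesz_leD ?rle_joinl ?rpos_ge0.
rewrite -rjoin_add_meet rpos_meet_neg addr0.
by do 2 apply: rjoin_le; rewrite ?rabs_ge0 ?rle_abs ?rleN_abs.
Qed.

Lemma rabsN x : rabs (- x) = rabs x.
Proof. by rewrite /rabs opprK rjoinC. Qed.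

Lemma rabs_id x : 0 <= x -> rabs x = x.
Proof.
move=> x0; rewrite rabsE rpos_id // rpos_eq0 ?addr0 //.
by rewrite riesz_oppr_le0.
Qed.

Lemma rabs0 : rabs (0 : E) = 0. Proof. exact: rabs_id. Qed.

Lemma rabsD x y : rabs (x + y) <= rabs x + rabs y.
Proof.
apply: rjoin_le; first by apply: riesz_leD; apply: rle_abs.
by rewrite opprD; apply: riesz_leD; apply: rleN_abs.
Qed.

Lemma rabsB x y : rabs (x - y) <= rabs x + rabs y.
Proof. by rewrite -(rabsN y) rabsD. Qed.

Lemma rabs_dist x y : rabs x <= rabs y + rabs (x - y).
Proof. by rewrite -{1}(subrKC y x); apply: rabsD. Qed.

Lemma rabsZ a x : rabs (a *: x) = `|a| *: rabs x.
Proof.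
have le c y : 0 <= c -> rabs (c *: y) <= c *: rabs y.
  by move=> c0; apply: rjoin_le; rewrite -?scalerN;
    apply: riesz_scale_le; rewrite ?rle_abs ?rleN_abs.
have pos c y : 0 <= c -> rabs (c *: y) = c *: rabs y.
  move=> c0; apply/le_anti; rewrite le //=.
  have [->|cn] := eqVneq c 0; first by rewrite !scale0r rabs0.
  (* For the reverse inequality, [le] is applied to the scalar [c^-1] and the vector [c *: y]. *)
  rewrite -[X in X <= _]scale1r -[X in _ <= X]scale1r -(mulfV cn) -!scalerA.
  apply: riesz_scale_le => //; rewrite scalerA mulVf // scale1r.
  rewrite -{1}[y]scale1r -(mulVf cn) -scalerA.
  by apply: le; rewrite invr_ge0.
have [a0|a0] := leP 0 a; first by rewrite ger0_norm ?pos.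
rewrite -rabsN -scaleNr pos ?ltr0_norm //.
by rewrite oppr_ge0 ltW.
Qed.

Lemma rpos_lip x y : rabs (rpos x - rpos y) <= rabs (x - y).
Proof.
have h u v : rpos u - rpos v <= rabs (u - v).
  rewrite riesz_leBlDr; apply: rjoin_le.
    rewrite -{1}(subrK v u).
    by apply: riesz_leD; [exact: rle_abs|exact: rle_joinl].
  by rewrite riesz_addr_ge0 ?rabs_ge0 ?rpos_ge0.
by apply: rjoin_le => //; rewrite opprB -rabsN opprB.
Qed.

Lemma rabsB_join_meet x y : rabs (x - y) = rjoin x y - rmeet x y.
Proof.
rewrite rabsE opprB /rpos.
have -> : rjoin (x - y) 0 = rjoin x y - y by rewrite rjoinD subrr.
have -> : rjoin (y - x) 0 = rjoin x y - x by rewrite rjoinD subrr rjoinC.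
by rewrite addrACA -opprD [y + x]addrC -(rjoin_add_meet x y) opprD addrA addrK.
Qed.

Lemma rjoin2 x y : rjoin x y *+ 2 = x + y + rabs (x - y).
Proof.
by rewrite rabsB_join_meet -(rjoin_add_meet x y) addrA addrAC addrK mulr2n.
Qed.

Lemma rmeet2 x y : rmeet x y *+ 2 = x + y - rabs (x - y).
Proof.
by rewrite rabsB_join_meet -(rjoin_add_meet x y) opprB addrC addrA subrK mulr2n.
Qed.

Lemma rmeet0_ge0l x y : rmeet x y = 0 -> 0 <= x.
Proof. by move=> <-; apply: rmeet_lel. Qed.

Lemma rmeet0_ge0r x y : rmeet x y = 0 -> 0 <= y.
Proof. by move=> <-; apply: rmeet_ler. Qed.

(** This identity translates between preserving disjointness and preserving [rabs]. *)
Lemma rmeet0_abs x y : 0 <= x -> 0 <= y ->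
  rmeet x y = 0 <-> rabs (x - y) = x + y.
Proof.
move=> x0 y0; split=> h.
  by rewrite rabsB_join_meet h subr0 -[LHS]addr0 -h rjoin_add_meet.
by apply: riesz_mulr2n_inj; rewrite rmeet2 h subrr mul0rn.
Qed.

Lemma rmeet0_le x y z t :
  0 <= x -> 0 <= y -> x <= z -> y <= t -> rmeet z t = 0 -> rmeet x y = 0.
Proof.
move=> x0 y0 xz yt h; apply/le_anti; rewrite rle_meet // andbT -h.
exact: rmeet_mono.
Qed.

(** With [m] the left-hand side, [m - rmeet q r] is the join of [m - q] and [m - r], and both lie
    below [p] and below [r]. *)
Lemma rmeetDl_le p q r : 0 <= p -> 0 <= q -> 0 <= r ->
  rmeet (p + q) r <= rmeet p r + rmeet q r.
Proof.
move=> p0 q0 r0; rewrite -riesz_leBlDr; set m := rmeet (p + q) r.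
have -> : m - rmeet q r = rjoin (m - q) (m - r).
  by rewrite -[q]opprK -[r in rmeet _ r]opprK -rjoinN !opprK addrC rjoinD
    ![_ + m]addrC.
apply: rle_meet; apply: rjoin_le; rewrite riesz_leBlDr.
- exact: rmeet_lel.
- by apply: le_trans (rmeet_ler _ _) _; rewrite addrC riesz_lerDl.
- by apply: le_trans (rmeet_ler _ _) _; rewrite riesz_lerDl.
- by apply: le_trans (rmeet_ler _ _) _; rewrite riesz_lerDl.
Qed.

Lemma rmeet0D p q r : rmeet p r = 0 -> rmeet q r = 0 -> rmeet (p + q) r = 0.
Proof.
move=> pr qr.
have p0 := rmeet0_ge0l pr; have q0 := rmeet0_ge0l qr; have r0 := rmeet0_ge0r pr.
apply/le_anti; rewrite rle_meet ?riesz_addr_ge0 // andbT.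
by apply: le_trans (rmeetDl_le _ _ _) _; rewrite // pr qr addr0.
Qed.

Lemma rmeet0Mn n p q : rmeet p q = 0 -> rmeet (p *+ n) q = 0.
Proof.
move=> pq; have q0 := rmeet0_ge0r pq.
elim: n => [|n IH]; first by apply/le_anti; rewrite rmeet_lel rle_meet.
by rewrite mulrS rmeet0D.
Qed.

Lemma rmeet0Z a p q : 0 <= a -> rmeet p q = 0 -> rmeet (a *: p) q = 0.
Proof.
move=> a0 pq; have p0 := rmeet0_ge0l pq; have q0 := rmeet0_ge0r pq.
(* A real scalar is dominated by a natural number, which reduces the claim to multiples. *)
have [n an] : exists n : nat, a <= n%:R.
  by exists (Num.trunc a).+1; rewrite ltW // Num.Theory.truncnS_gt.
apply: rmeet0_le (rmeet0Mn n pq) => //; first exact: rscale_ge0.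
by rewrite -scaler_nat riesz_scale_lel.
Qed.

End RieszTheory.

(** * Linear maps, Riesz homomorphisms and bimorphisms *)

Section LinearMaps.
Variables (R : realType).
Implicit Types E F G H : rieszType R.

Lemma lin0 E F (f : E -> F) : linear f -> f 0 = 0.
Proof. by move=> lf; have := lf (-1) 0 0; rewrite !scaleN1r !addNr. Qed.

Lemma linD E F (f : E -> F) : linear f -> {morph f : x y / x + y}.
Proof. by move=> lf x y; rewrite -[x]scale1r lf !scale1r. Qed.

Lemma linZ E F (f : E -> F) : linear f -> forall a x, f (a *: x) = a *: f x.
Proof. by move=> lf a x; rewrite -[a *: x]addr0 lf lin0 // addr0. Qed.

Lemma linN E F (f : E -> F) : linear f -> {morph f : x / - x}.
Proof. by move=> lf x; rewrite -scaleN1r linZ // scaleN1r. Qed.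

Lemma linB E F (f : E -> F) : linear f -> {morph f : x y / x - y}.
Proof. by move=> lf x y; rewrite linD // linN. Qed.

Lemma linMn E F (f : E -> F) : linear f -> forall n x, f (x *+ n) = f x *+ n.
Proof. by move=> lf n x; rewrite -!scaler_nat linZ. Qed.

Lemma lin_abs_le E F (f : E -> F) : linear f ->
  forall x, rabs (f x) <= rabs (f (rpos x)) + rabs (f (rpos (- x))).
Proof. by move=> lf x; rewrite -{1}(rposBneg x) linB // rabsB. Qed.

Lemma lin_eq E F (f g : E -> F) : linear f -> linear g ->
  (forall x, 0 <= x -> f x = g x) -> f =1 g.
Proof.
by move=> lf lg fg x; rewrite -(rposBneg x) !linB // !fg // rpos_ge0.
Qed.

Lemma comp_linear E F G (f : F -> G) (g : E -> F) :
  linear f -> linear g -> linear (f \o g).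
Proof. by move=> lf lg a x y /=; rewrite lg lf. Qed.

Lemma riesz_hom_ge0 E F (f : E -> F) :
  riesz_hom f -> forall x, 0 <= x -> 0 <= f x.
Proof. by move=> [_ fa] x x0; rewrite -(rabs_id x0) fa rabs_ge0. Qed.

Lemma riesz_hom_le E F (f : E -> F) :
  riesz_hom f -> {homo f : x y / x <= y}.
Proof.
move=> hf x y xy; rewrite -riesz_subr_ge0 -linB; last by case: hf.
by apply: riesz_hom_ge0; rewrite ?riesz_subr_ge0.
Qed.

Lemma riesz_hom_disjoint E F (f : E -> F) : riesz_hom f ->
  forall x y, rmeet x y = 0 -> rmeet (f x) (f y) = 0.
Proof.
move=> hf x y xy; have [lf fa] := hf.
have [x0 y0] := (rmeet0_ge0l xy, rmeet0_ge0r xy).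
apply/rmeet0_abs; try exact: riesz_hom_ge0.
by rewrite -linB // -fa -linD //; congr f; apply/rmeet0_abs.
Qed.

(** The images of the positive and negative parts of [x] are disjoint, so the absolute value of
    their difference is their sum, which is [f (rabs x)]. *)
Lemma disjoint_riesz_hom E F (f : E -> F) : linear f ->
    (forall x, 0 <= x -> 0 <= f x) ->
    (forall x y, rmeet x y = 0 -> rmeet (f x) (f y) = 0) ->
  riesz_hom f.
Proof.
move=> lf f0 fd; split=> // x.
rewrite rabsE linD // -{3}(rposBneg x) linB //; symmetry.
by apply/rmeet0_abs; rewrite ?fd ?f0 ?rpos_ge0 // rpos_meet_neg.
Qed.

Lemma riesz_hom_comp E F G (f : F -> G) (g : E -> F) :
  riesz_hom f -> riesz_hom g -> riesz_hom (f \o g).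
Proof.
move=> [lf fa] [lg ga]; split; first exact: comp_linear.
by move=> x /=; rewrite ga fa.
Qed.

Lemma riesz_hom_id E : riesz_hom (@id E).
Proof. by split. Qed.

Lemma bimorphism_abs_le E F G (phi : E -> F -> G) : riesz_bimorphism phi ->
  forall x y, rabs (phi x y) <= phi (rabs x) (rabs y).
Proof.
move=> [[ll lr] hl hr] x y.
apply: le_trans (lin_abs_le (ll y) x) _.
rewrite -(hr _ (rpos_ge0 x)).2 -(hr _ (rpos_ge0 (- x))).2.
by rewrite [X in _ <= phi X _]rabsE (linD (ll _)).
Qed.

Lemma bimorphism_ge0 E F G (phi : E -> F -> G) : riesz_bimorphism phi ->
  forall x y, 0 <= x -> 0 <= y -> 0 <= phi x y.
Proof. by move=> [_ _ hr] x y x0 y0; apply: riesz_hom_ge0 (hr x x0) _ y0. Qed.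

Lemma bimorphism_le E F G (phi : E -> F -> G) : riesz_bimorphism phi ->
  forall x x' y y', 0 <= x -> x <= x' -> 0 <= y -> y <= y' ->
    phi x y <= phi x' y'.
Proof.
move=> [_ hl hr] x x' y y' x0 xx y0 yy.
apply: (@le_trans _ _ (phi x' y)).
  by apply: riesz_hom_le (hl y y0) _ _ xx.
by apply: (riesz_hom_le (hr x' _)) => //; apply: le_trans xx.
Qed.

Lemma bimorphism_comp E F G H (f : G -> H) (phi : E -> F -> G) :
  riesz_hom f -> riesz_bimorphism phi ->
  riesz_bimorphism (fun x y => f (phi x y)).
Proof.
move=> hf [[ll lr] hl hr]; have lf := hf.1; split; first split.
- by move=> y; apply: comp_linear lf (ll y).
- by move=> x; apply: comp_linear lf (lr x).
- by move=> y y0; apply: riesz_hom_comp hf (hl y y0).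
- by move=> x x0; apply: riesz_hom_comp hf (hr x x0).
Qed.

Lemma bimorphism_comp2 E F (E' F' : rieszType R) G (f : E -> E') (g : F -> F')
    (phi : E' -> F' -> G) :
  riesz_hom f -> riesz_hom g -> riesz_bimorphism phi ->
  riesz_bimorphism (fun x y => phi (f x) (g y)).
Proof.
move=> hf hg [[ll lr] hl hr]; split; first split.
- by move=> y; apply: comp_linear (ll (g y)) hf.1.
- by move=> x; apply: comp_linear (lr (f x)) hg.1.
- move=> y y0; apply: (riesz_hom_comp (f := phi^~ (g y)) _ hf); apply: hl.
  exact: riesz_hom_ge0 hg _ y0.
- move=> x x0; apply: (riesz_hom_comp (f := phi (f x)) _ hg); apply: hr.
  exact: riesz_hom_ge0 hf _ x0.
Qed.

Lemma bimorphism_flip E F G (phi : E -> F -> G) :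
  riesz_bimorphism phi -> riesz_bimorphism (fun y x => phi x y).
Proof. by move=> [[ll lr] hl hr]; split. Qed.

End LinearMaps.

(** * Kantorovich extension from the positive cone *)

Section PositiveExtension.
Variables (R : realType) (E F : rieszType R) (q : E -> F).
Hypothesis qD : forall a b, 0 <= a -> 0 <= b -> q (a + b) = q a + q b.
Hypothesis qZ : forall c a, 0 <= c -> 0 <= a -> q (c *: a) = c *: q a.

Definition positive_extension a := q (rpos a) - q (rpos (- a)).

(** The extension can be computed from any decomposition into positive elements: two decompositions
    of the same element give equal sums of positive elements, to which additivity of [q] applies. *)
Lemma positive_extensionB u v :
  0 <= u -> 0 <= v -> positive_extension (u - v) = q u - q v.
Proof.
move=> u0 v0; have h := rposBneg (u - v).
have e : u + rpos (- (u - v)) = rpos (u - v) + v.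
  by rewrite -[rpos (u - v)](subrK (rpos (- (u - v)))) h addrAC subrK.
have := congr1 q e; rewrite !qD ?rpos_ge0 // => qe.
apply/eqP; rewrite subr_eq addrAC eq_sym subr_eq; apply/eqP; exact: qe.
Qed.

Lemma positive_extensionE a : 0 <= a -> positive_extension a = q a.
Proof.
move=> a0; rewrite -{1}[a]subr0 positive_extensionB //.
by rewrite -(scale0r (0 : E)) qZ // scale0r subr0.
Qed.

Lemma positive_extension_linear : linear positive_extension.
Proof.
have D : {morph positive_extension : x y / x + y}.
  move=> x y; rewrite -{1}(rposBneg x) -{1}(rposBneg y) addrACA -opprD.
  rewrite positive_extensionB ?riesz_addr_ge0 ?rpos_ge0 //.
  by rewrite !qD ?rpos_ge0 // opprD addrACA.
have Z c x : 0 <= c -> positive_extension (c *: x) = c *: positive_extension x.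
  move=> c0; rewrite -{1}(rposBneg x) scalerBr positive_extensionB;
    rewrite ?rscale_ge0 ?rpos_ge0 //.
  by rewrite !qZ ?rpos_ge0 // scalerBr.
have N x : positive_extension (- x) = - positive_extension x.
  by rewrite /positive_extension opprK opprB.
move=> c x y; rewrite D; congr (_ + _).
have [c0|c0] := leP 0 c; first exact: Z.
rewrite -[c]opprK [- - c *: x]scaleNr [RHS]scaleNr N Z //.
by rewrite oppr_ge0 ltW.
Qed.

End PositiveExtension.

(* Meyer's theorem. For [z_k = (n - k) a - k b], the summands of
   [f z_k = f z_k^+ - f z_k^-] are disjoint and move by at most a fixed bound
   [h] when [k] grows by one. As [z_k] runs from [n a] to [- n b], it switches from
   one summand to the other, and at the switch both are at most [h]. *)
Section Meyer.
Variables (R : realType) (E F : rieszType R) (f : E -> F).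

Definition order_bounded :=
  forall c, exists h, forall x, rabs x <= c -> rabs (f x) <= h.

Definition disjointness_preserving :=
  forall x y, rmeet x y = 0 -> rmeet (rabs (f x)) (rabs (f y)) = 0.

Hypothesis F_arch : archimedean F.
Hypothesis f_lin : linear f.
Hypothesis f_ob : order_bounded.
Hypothesis f_disj : disjointness_preserving.

Lemma meyer a b : 0 <= a -> 0 <= b -> rmeet (rpos (f a)) (rpos (- f b)) = 0.
Proof.
move=> a0 b0; set w := rmeet _ _.
have w0 : 0 <= w by rewrite rle_meet ?rpos_ge0.
have [h hP] := f_ob (a + b).
(* It suffices to bound every multiple of [w] by [h], the bound of [f] on the elements with
   [rabs x <= a + b]. *)
apply: (F_arch (y := h)) => // [|n].
  by apply: le_trans (hP 0 _); rewrite ?rabs_ge0 // rabs0 riesz_addr_ge0.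
(* The estimates below take [k <= n], where the natural difference [n - k] is exact. *)
pose z k := a *+ (n - k) - (b *+ k).
pose al k := rabs (f (rpos (z k))); pose be k := rabs (f (rpos (- z k))).
have albe k : rmeet (al k) (be k) = 0 by apply/f_disj/rpos_meet_neg.
have wle k : (k <= n)%N -> w *+ n <= rjoin (al k) (be k).
  move=> kn; rewrite -[rjoin _ _]addr0 -(albe k) rjoin_add_meet.
  apply: (@le_trans _ _ (rpos (f (z k)))); last first.
    apply: rjoin_le; last by rewrite riesz_addr_ge0 ?rabs_ge0.
    rewrite -{1}(rposBneg (z k)) (linB f_lin).
    by apply: riesz_leD; [exact: rle_abs|exact: rleN_abs].
  pose t := rpos (- f a) *+ (n - k) + (rpos (f b) *+ k).
  have wt : rmeet (w *+ n) t = 0.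
    rewrite rmeet0Mn // rmeetC rmeet0D //; apply: rmeet0Mn.
      apply: rmeet0_le (rpos_meet_neg (- f a)); rewrite ?rpos_ge0 ?w0 //.
      by rewrite opprK rmeet_lel.
    apply: rmeet0_le (rpos_meet_neg (f b)); rewrite ?rpos_ge0 ?w0 //.
    exact: rmeet_ler.
  have t0 := rmeet0_ge0r wt.
  have wst : w *+ n <= rpos (f (z k)) + t.
    rewrite -{1}(subnK kn) mulrnDr.
    apply: (@le_trans _ _ (rpos (f a) *+ (n - k) + (rpos (- f b) *+ k))).
      by apply: riesz_leD; apply: riesz_mulrn_le;
        rewrite ?rmeet_lel ?rmeet_ler.
    have -> : rpos (f a) *+ (n - k) + (rpos (- f b) *+ k) = f (z k) + t.
      have gen (p q p' q' : F) : p *+ (n - k) + q' *+ k =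
          (p - q) *+ (n - k) - (p' - q') *+ k + (q *+ (n - k) + p' *+ k).
        rewrite !mulrnBl opprB addrACA subrK; congr (_ + _).
        by rewrite subrK.
      rewrite (gen _ (rpos (- f a)) (rpos (f b))) !rposBneg.
      by rewrite /t (linB f_lin) !(linMn f_lin).
    by rewrite riesz_leD2r rle_joinl.
  have s0 := rpos_ge0 (f (z k)).
  rewrite -[rpos _]addr0 -wt rmeetC.
  rewrite -[X in X <= _](_ : rmeet (rpos (f (z k)) + t) (w *+ n) = _).
    apply: le_trans (rmeetDl_le _ _ _) _; rewrite ?riesz_mulrn_ge0 //.
    by rewrite riesz_leD2r rmeet_lel.
  by apply/le_anti; rewrite rmeet_ler rle_meet.
have zS k : (k < n)%N -> z k - z k.+1 = a + b.
  move=> kn; rewrite /z -(subnSK kn) !mulrS opprB addrACA -opprD.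
  by rewrite [_ + (b + _)]addrACA [b *+ k + _]addrC addrK.
have step k : (k < n)%N -> be k.+1 <= be k + h.
  move=> kn; apply: le_trans (rabs_dist _ (f (rpos (- z k)))) _.
  rewrite riesz_leD2l -(linB f_lin) hP //.
  apply: le_trans (rpos_lip _ _) _.
  by rewrite opprK addrC zS // rabs_id ?riesz_addr_ge0.
have h0 : 0 <= h.
  by apply: le_trans (hP 0 _); rewrite ?rabs_ge0 // rabs0 riesz_addr_ge0.
(* Induction along [k], starting from [be 0 = 0]. In the step the meet of the bounds [wle k.+1] and
   [IH] is distributed. The only delicate term is the meet of [be k.+1] and [al k]; it is at most
   [h], because [be k.+1 <= be k + h] and [be k] is disjoint from [al k]. *)
have main k : (k <= n)%N -> w *+ n <= rjoin (al k) h.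
  elim: k => [|k IH] kn.
    apply: le_trans (wle 0%N kn) _; apply: rjoin_le; first exact: rle_joinl.
    rewrite /be /z subn0 mulr0n subr0 rpos_eq0 ?(lin0 f_lin) ?rabs0 //.
      exact: le_trans (rle_joinr _ _).
    by rewrite riesz_oppr_le0 riesz_mulrn_ge0.
  apply: (@le_trans _ _ (rmeet (rjoin (al k.+1) (be k.+1)) (rjoin (al k) h))).
    by apply: rle_meet; [exact: wle|apply: IH; exact: ltnW].
  apply: le_trans (rmeetUl _ _ _) _.
  apply: rjoin_le; first exact: le_trans (rmeet_lel _ _) (rle_joinl _ _).
  rewrite rmeetC; apply: le_trans (rmeetUl _ _ _) _.
  apply: le_trans (rle_joinr _ _); apply: rjoin_le; last exact: rmeet_lel.
  apply: (@le_trans _ _ (rmeet (be k + h) (al k))).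
    by rewrite rmeetC; apply: rmeet_mono (step _ kn) _.
  apply: le_trans (rmeetDl_le _ _ _) _; rewrite ?rabs_ge0 //.
  by rewrite rmeetC albe add0r rmeet_lel.
(* At [k = n] the element [z n] is [- (b *+ n) <= 0], so [al n] vanishes and only [h] is left. *)
apply: le_trans (main n (leqnn n)) _; apply: rjoin_le => //.
rewrite /al /z subnn mulr0n add0r rpos_eq0 ?(lin0 f_lin) ?rabs0 //.
by rewrite riesz_oppr_le0 riesz_mulrn_ge0.
Qed.

(** Meyer's theorem, used for [(a, b)] and [(b, a)], makes the sum of the positive parts of [f a]
    and [f b] disjoint from the sum of their negative parts. *)
Lemma meyer_abs_add a b : 0 <= a -> 0 <= b ->
  rabs (f (a + b)) = rabs (f a) + rabs (f b).
Proof.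
move=> a0 b0; have pab := meyer a0 b0; have pba := meyer b0 a0.
rewrite (linD f_lin) -{1}(rposBneg (f a)) -{1}(rposBneg (f b)) addrACA -opprD.
have -> : rabs (f a) + rabs (f b) =
    rpos (f a) + rpos (f b) + (rpos (- f a) + rpos (- f b)).
  by rewrite !rabsE addrACA.
apply/rmeet0_abs; rewrite ?riesz_addr_ge0 ?rpos_ge0 //.
by apply: rmeet0D; rewrite rmeetC; apply: rmeet0D; rewrite rmeetC //;
  apply: rpos_meet_neg.
Qed.

End Meyer.

(** * The Archimedean Riesz space of operators in a class *)

Section Operators.
Variables (R : realType) (E F : rieszType R).

(* The ideals of order bounded disjointness preserving operators that are
   closed under addition: on these, [|f|(a) = |f a|] for [a >= 0]. *)
Record opclass := OpClass {
  oc_mem :> (E -> F) -> Prop ;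
  oc_arch : archimedean F ;
  oc_linear : forall f, oc_mem f -> linear f ;
  oc_bounded : forall f, oc_mem f -> order_bounded f ;
  oc_disjoint : forall f, oc_mem f -> disjointness_preserving f ;
  oc_zero : oc_mem (fun=> 0) ;
  oc_comb : forall c f g, oc_mem f -> oc_mem g ->
    oc_mem (fun x => c *: f x + g x) ;
  oc_solid : forall f g, oc_mem f -> linear g ->
    (forall a, 0 <= a -> rabs (g a) <= rabs (f a)) -> oc_mem g
}.

Variable K : opclass.

Record op := Op { op_fun :> E -> F ; op_mem : K op_fun }.

Implicit Types f g h : op.

Lemma op_linear f : linear f. Proof. exact: oc_linear (op_mem f). Qed.

(** Equality is tested on the positive cone because the order and the lattice operations are
    pointwise there, and only there. *)
Lemma op_eq f g : (forall a, 0 <= a -> f a = g a) -> f = g.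
Proof.
move=> fg; have : op_fun f = op_fun g.
  by apply: funext; apply: lin_eq fg; apply: op_linear.
case: f g {fg} => [f Kf] [g Kg] /= fg; case: _ / fg Kg => Kg.
by congr Op; apply: Prop_irrelevance.
Qed.

HB.instance Definition _ := gen_eqMixin op.
HB.instance Definition _ := gen_choiceMixin op.

Definition op_zero := Op (oc_zero K).

Lemma op_add_subproof f g : K (fun x => f x + g x).
Proof.
rewrite [X in K X](_ : _ = fun x => 1 *: f x + g x); last first.
  by apply: funext => x; rewrite scale1r.
by apply: oc_comb; apply: op_mem.
Qed.

Definition op_add f g := Op (op_add_subproof f g).

Lemma op_scale_subproof (c : R) f : K (fun x => c *: f x).
Proof.
rewrite [X in K X](_ : _ = fun x => c *: f x + 0); last first.
  by apply: funext => x; rewrite addr0.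
by apply: oc_comb; [apply: op_mem|apply: oc_zero].
Qed.

Definition op_scale c f := Op (op_scale_subproof c f).

Definition op_opp f := op_scale (-1) f.

Lemma op_addA : associative op_add.
Proof. by move=> f g h; apply: op_eq => a _ /=; rewrite addrA. Qed.

Lemma op_addC : commutative op_add.
Proof. by move=> f g; apply: op_eq => a _ /=; rewrite addrC. Qed.

Lemma op_add0 : left_id op_zero op_add.
Proof. by move=> f; apply: op_eq => a _ /=; rewrite add0r. Qed.

Lemma op_addN : left_inverse op_zero op_opp op_add.
Proof. by move=> f; apply: op_eq => a _ /=; rewrite scaleN1r addNr. Qed.

HB.instance Definition _ :=
  GRing.isZmodule.Build op op_addA op_addC op_add0 op_addN.

Lemma op_scaleA c d f : op_scale c (op_scale d f) = op_scale (c * d) f.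
Proof. by apply: op_eq => a _ /=; rewrite scalerA. Qed.

Lemma op_scale1 : left_id 1 op_scale.
Proof. by move=> f; apply: op_eq => a _ /=; rewrite scale1r. Qed.

Lemma op_scaleDr : right_distributive op_scale +%R.
Proof. by move=> c f g; apply: op_eq => a _ /=; rewrite scalerDr. Qed.

Lemma op_scaleDl f : {morph op_scale^~ f : c d / c + d}.
Proof. by move=> c d; apply: op_eq => a _ /=; rewrite scalerDl. Qed.

HB.instance Definition _ := GRing.Zmodule_isLmodule.Build R op
  op_scaleA op_scale1 op_scaleDr op_scaleDl.

Definition op_le f g := `[< forall a, 0 <= a -> f a <= g a >].

Lemma op_le_refl : reflexive op_le.
Proof. by move=> f; apply/asboolP => a _; apply: lexx. Qed.

Lemma op_le_anti : antisymmetric op_le.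
Proof.
move=> f g /andP[/asboolP fg /asboolP gf]; apply: op_eq => a a0.
by apply/le_anti; rewrite fg ?gf.
Qed.

Lemma op_le_trans : transitive op_le.
Proof.
move=> g f h /asboolP fg /asboolP gh; apply/asboolP => a a0.
exact: le_trans (fg a a0) (gh a a0).
Qed.

HB.instance Definition _ := Order.Le_isPOrder.Build ring_display op
  op_le_refl op_le_anti op_le_trans.

Lemma op_leP f g : reflect (forall a, 0 <= a -> f a <= g a) (f <= g).
Proof. exact: asboolP. Qed.

Lemma op_addE f g a : (f + g) a = f a + g a. Proof. by []. Qed.

Lemma op_scaleE (c : R) f a : (c *: f) a = c *: f a. Proof. by []. Qed.

Lemma op_oppE f a : (- f) a = - f a. Proof. exact: scaleN1r. Qed.

(** The modulus of [f]: its values on the cone are additive by Meyer's theorem, hence extend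
    linearly. *)
Let op_abs_fun f := positive_extension (fun a => rabs (f a)).

Lemma op_abs_funD f a b : 0 <= a -> 0 <= b ->
  rabs (f (a + b)) = rabs (f a) + rabs (f b).
Proof.
apply: meyer_abs_add; first exact: oc_arch K.
- exact: op_linear.
- exact: oc_bounded (op_mem f).
- exact: oc_disjoint (op_mem f).
Qed.

Lemma op_abs_funZ f c a : 0 <= c -> 0 <= a ->
  rabs (f (c *: a)) = c *: rabs (f a).
Proof.
by move=> c0 _; rewrite (linZ (@op_linear f)) rabsZ ger0_norm.
Qed.

Lemma op_abs_funE f a : 0 <= a -> op_abs_fun f a = rabs (f a).
Proof.
by apply: positive_extensionE; [apply: op_abs_funD|apply: op_abs_funZ].
Qed.

Lemma op_abs_subproof f : K (op_abs_fun f).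
Proof.
apply: (oc_solid (op_mem f)) => [|a a0].
  by apply: positive_extension_linear; [apply: op_abs_funD|apply: op_abs_funZ].
by rewrite op_abs_funE // rabs_id ?rabs_ge0.
Qed.

Definition op_abs f := Op (op_abs_subproof f).

(** Join and meet are recovered from the modulus by the identities [rjoin2] and [rmeet2], so that at
    a positive point they are the join and meet of the values. *)
Definition op_join f g := (2%:R : R)^-1 *: (f + g + op_abs (f - g)).
Definition op_meet f g := (2%:R : R)^-1 *: (f + g - op_abs (f - g)).

Lemma op_joinE f g a : 0 <= a -> op_join f g a = rjoin (f a) (g a).
Proof.
move=> a0; rewrite /op_join op_scaleE !op_addE [op_abs _ _]op_abs_funE //.
by rewrite op_addE op_oppE -rjoin2 riesz_halfK.
Qed.

Lemma op_meetE f g a : 0 <= a -> op_meet f g a = rmeet (f a) (g a).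
Proof.
move=> a0; rewrite /op_meet op_scaleE !op_addE op_oppE.
rewrite [op_abs _ _]op_abs_funE // op_addE op_oppE.
by rewrite -rmeet2 riesz_halfK.
Qed.

Lemma op_leUx f g h : (op_join f g <= h) = (f <= h) && (g <= h).
Proof.
apply/op_leP/andP => [fgh|[/op_leP fh /op_leP gh] a a0].
  split; apply/op_leP => a a0; apply: le_trans (fgh a a0);
    rewrite op_joinE ?rle_joinl ?rle_joinr //.
by rewrite op_joinE // rjoin_le ?fh ?gh.
Qed.

Lemma op_lexI f g h : (h <= op_meet f g) = (h <= f) && (h <= g).
Proof.
apply/op_leP/andP => [fgh|[/op_leP fh /op_leP gh] a a0].
  split; apply/op_leP => a a0; apply: le_trans (fgh a a0) _;
    rewrite op_meetE ?rmeet_lel ?rmeet_ler //.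
by rewrite op_meetE // rle_meet ?fh ?gh.
Qed.

Lemma op_leD2r f g h : f <= g -> f + h <= g + h.
Proof.
by move=> /op_leP fg; apply/op_leP => a a0; rewrite !op_addE rleD2r ?fg.
Qed.

Lemma op_scale_ge0 (c : R) f : 0 <= c -> 0 <= f -> 0 <= c *: f.
Proof.
by move=> c0 /op_leP f0; apply/op_leP => a a0; rewrite rscale_ge0 ?f0.
Qed.

HB.instance Definition _ := isRiesz.Build R op
  op_leUx op_lexI op_leD2r op_scale_ge0.

Lemma op_rabsE f a : 0 <= a -> rabs f a = rabs (f a).
Proof. by move=> a0; rewrite [LHS]op_joinE // op_oppE. Qed.

Lemma op_rmeetE f g a : 0 <= a -> rmeet f g a = rmeet (f a) (g a).
Proof. exact: op_meetE. Qed.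

Lemma op_mulrnE f n a : (f *+ n) a = f a *+ n.
Proof. by elim: n => [//|n IH]; rewrite !mulrS op_addE IH. Qed.

Lemma op_ge0 f a : 0 <= f -> 0 <= a -> 0 <= f a.
Proof. by move=> /op_leP f0; apply: f0. Qed.

Lemma op_archimedean : archimedean op.
Proof.
move=> f g f0 g0 fg; apply: op_eq => a a0; apply: (oc_arch K) (g a) _ _ _ => //.
- exact: op_ge0.
- exact: op_ge0.
- by move=> n; rewrite -op_mulrnE; apply: (op_leP _ _ (fg n)).
Qed.

Lemma op_eval_linear a : linear (fun f : op => f a).
Proof. by []. Qed.

Lemma op_eval_riesz_hom a : 0 <= a -> riesz_hom (fun f : op => f a).
Proof. by move=> a0; split=> [|f]; [exact: op_eval_linear|exact: op_rabsE]. Qed.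

Lemma op_ge0_riesz_hom f : 0 <= f -> riesz_hom f.
Proof.
move=> f0; apply: disjoint_riesz_hom => [||x y xy].
- exact: op_linear.
- by move=> a; apply: op_ge0.
- have [x0 y0] := (rmeet0_ge0l xy, rmeet0_ge0r xy).
  have := oc_disjoint (op_mem f) xy.
  by rewrite !rabs_id ?op_ge0.
Qed.

End Operators.

(** * Symmetry and uniqueness for the tensor product *)

Section TensorBasics.
Variables (R : realType) (A B T : rieszType R) (tens : A -> B -> T).
Hypothesis tensP : riesz_tensor_product tens.

(** By this symmetry the action of [B] is an instance of the action of the left factor. *)
Lemma tensor_flip : riesz_tensor_product (fun b a => tens a b).
Proof.
have [Ta tb univ] := tensP; split=> //; first exact: bimorphism_flip.
move=> G Ga phi phib.
have [h [[hh hE] hu]] := univ G Ga _ (bimorphism_flip phib).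
exists h; split; first by split.
by move=> g [gh gE]; apply: hu; split.
Qed.

(** Bilinearity carries the agreement from positive tensors to all tensors, where the uniqueness
    clause of the universal property takes over. *)
Lemma tensor_hom_eq (G : rieszType R) (f g : T -> G) : archimedean G ->
    riesz_hom f -> riesz_hom g ->
    (forall x y, 0 <= x -> 0 <= y -> f (tens x y) = g (tens x y)) ->
  f =1 g.
Proof.
have [_ tb univ] := tensP; move=> Ga hf hg fg.
have [[ll lr] _ _] := tb.
have fb := bimorphism_comp hf tb; have gb := bimorphism_comp hg tb.
have [[fl fr] _ _] := fb; have [[gl gr] _ _] := gb.
have fgE x y : f (tens x y) = g (tens x y).
  have step y' : 0 <= y' -> f (tens x y') = g (tens x y').
    by move=> y0; apply: (lin_eq (fl y') (gl y') _ x) => x' x0; apply: fg.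
  exact: (lin_eq (fr x) (gr x) step y).
have [h [_ hu]] := univ G Ga _ fb.
have hf' : h = f by apply: hu.
have hg' : h = g by apply: hu; split=> // x y; rewrite fgE.
by rewrite -hf' hg'.
Qed.

(** A bimorphism is a Riesz homomorphism in one variable once the other is fixed and positive, so
    [tensor_hom_eq] is used once in each variable. *)
Lemma tensor_bimorphism_eq (G : rieszType R) (f g : T -> T -> G) :
    archimedean G -> riesz_bimorphism f -> riesz_bimorphism g ->
    (forall x y x' y', 0 <= x -> 0 <= y -> 0 <= x' -> 0 <= y' ->
       f (tens x y) (tens x' y') = g (tens x y) (tens x' y')) ->
  f =2 g.
Proof.
move=> Ga [[fl fr] fhl fhr] [[gl gr] ghl ghr] fg u v.
have [_ tb _] := tensP.
apply: lin_eq (fr u) (gr u) _ v => v v0.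
apply: (tensor_hom_eq Ga (fhl v v0) (ghl v v0)) => x y x0 y0 /=.
have xy0 := bimorphism_ge0 tb x0 y0.
apply: (tensor_hom_eq Ga (fhr _ xy0) (ghr _ xy0)) => x' y' x'0 y'0.
exact: fg.
Qed.

End TensorBasics.

(** * Elementary f-algebra theory *)

Section FAlgebra.
Variables (R : realType) (A : rieszType R) (mul : A -> A -> A).
Hypothesis mulP : f_algebra mul.

Lemma falg_bimorphism : riesz_bimorphism mul.
Proof.
have [[[ll lr] _ m0] md] := mulP; split=> // y y0.
- apply: disjoint_riesz_hom => // [x x0|p q pq]; first exact: m0.
  have h := (md p q y pq y0).1; rewrite rmeetC in h.
  by rewrite rmeetC; exact: (md _ _ y h y0).1.
- apply: disjoint_riesz_hom => // [x x0|p q pq]; first exact: m0.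
  have h := (md p q y pq y0).2; rewrite rmeetC in h.
  by rewrite rmeetC; exact: (md _ _ y h y0).2.
Qed.

(** The f-algebra condition, used once for each factor, makes [mul x y] disjoint from itself. *)
Lemma falg_mul_disjoint x y : rmeet x y = 0 -> mul x y = 0.
Proof.
move=> xy; have [_ md] := mulP.
have h := (md x y y xy (rmeet0_ge0r xy)).1; rewrite rmeetC in h.
have := (md _ _ x h (rmeet0_ge0l xy)).2.
move=> h'; apply/le_anti; rewrite (rmeet0_ge0l h') andbT.
by have := rle_meet (lexx (mul x y)) (lexx _); rewrite h'.
Qed.

(** The cross terms in the square of [rpos x - rpos (- x)] vanish by disjointness. *)
Lemma falg_sqr_ge0 x : 0 <= mul x x.
Proof.
have [[[ll lr] _ m0] _] := mulP.
rewrite -(rposBneg x) (linB (ll _)) !(linB (lr _)).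
rewrite (falg_mul_disjoint (rpos_meet_neg x)) subr0.
rewrite [mul (rpos (- x)) (rpos x)]falg_mul_disjoint; last first.
  by rewrite rmeetC rpos_meet_neg.
by rewrite sub0r opprK riesz_addr_ge0 ?m0 ?rpos_ge0.
Qed.

(** Expanding the positive square of [x - e *+ n] bounds even twice the left-hand side. *)
Lemma falg_mulrn_le e n x : left_id e mul -> right_id e mul -> 0 <= x ->
  x *+ n <= e *+ n *+ n + mul x x.
Proof.
move=> e1 e2 x0; have [[[ll lr] _ m0] _] := mulP.
have := falg_sqr_ge0 (x - e *+ n).
rewrite (linB (ll _)) !(linB (lr _)) !(linMn (ll _)) !(linMn (lr _)) !e1 e2.
rewrite opprB addrACA -opprD riesz_subr_ge0 [mul x x + _]addrC.
by apply: le_trans; rewrite riesz_lerDl riesz_mulrn_ge0.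
Qed.

End FAlgebra.

(** * The action of one factor on the tensor product *)

(* The operators [x (x) y |-> (a x) (x) y] are obtained for all [a] at once, by
   applying the universal property of [T] to operators from [A] to [T]; this is
   what makes them additive in [a]. *)
Section LeftAction.
Variables (R : realType) (A B T : rieszType R) (tens : A -> B -> T).
Variable mul : A -> A -> A.
Hypothesis tensP : riesz_tensor_product tens.
Hypothesis mulP : f_algebra mul.

Let tens_bi : riesz_bimorphism tens. Proof. by case: tensP. Qed.

Let mul_bi : riesz_bimorphism mul. Proof. exact: falg_bimorphism. Qed.

(** The dominating map is a Riesz homomorphism, which makes [f] order bounded and disjointness
    preserving. Domination by a single such map is stable under sums because [x] and [y] can both be
    enlarged. *)
Definition tensor_dominated (f : A -> T) :=
  linear f /\ exists x y, [/\ 0 <= x, 0 <= y &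
    forall a, 0 <= a -> rabs (f a) <= tens (mul a x) y].

Let dominator x y (y0 : 0 <= y) (x0 : 0 <= x) :
  riesz_hom (fun a => tens (mul a x) y).
Proof.
have [_ hl _] := tens_bi; have [_ ml _] := mul_bi.
exact: (riesz_hom_comp (hl y y0) (ml x x0)).
Qed.

Lemma tensor_dominated_abs_le f x y : linear f -> 0 <= x -> 0 <= y ->
    (forall a, 0 <= a -> rabs (f a) <= tens (mul a x) y) ->
  forall a, rabs (f a) <= tens (mul (rabs a) x) y.
Proof.
move=> lf x0 y0 fd a; apply: le_trans (lin_abs_le lf a) _.
rewrite (rabsE a) (linD (dominator y0 x0).1).
by apply: riesz_leD; apply: fd; apply: rpos_ge0.
Qed.

Lemma tensor_dominated_bounded f : tensor_dominated f -> order_bounded f.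
Proof.
move=> [lf [x [y [x0 y0 fd]]]] c; exists (tens (mul c x) y) => a ac.
apply: le_trans (tensor_dominated_abs_le lf x0 y0 fd a) _.
exact: riesz_hom_le (dominator y0 x0) _ _ ac.
Qed.

Lemma tensor_dominated_disjoint f :
  tensor_dominated f -> disjointness_preserving f.
Proof.
move=> [lf [x [y [x0 y0 fd]]]] p q pq.
apply: rmeet0_le (riesz_hom_disjoint (dominator y0 x0) pq);
  rewrite ?rabs_ge0 ?fd //.
- exact: rmeet0_ge0l pq.
- exact: rmeet0_ge0r pq.
Qed.

Lemma tensor_dominated0 : tensor_dominated (fun=> 0).
Proof.
split; first by move=> c u v; rewrite scaler0 addr0.
exists 0, 0; split=> // a a0; rewrite rabs0.
exact: riesz_hom_ge0 (dominator _ _) _ a0.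
Qed.

Lemma tensor_dominated_comb (c : R) f g :
  tensor_dominated f -> tensor_dominated g ->
  tensor_dominated (fun a => c *: f a + g a).
Proof.
move=> [lf [x [y [x0 y0 fd]]]] [lg [x' [y' [x'0 y'0 gd]]]]; split.
  move=> d u v; rewrite lf lg !scalerDr !scalerA [c * d]mulrC.
  by rewrite addrACA.
exists (`|c| *: x + x'), (y + y').
have cx0 : 0 <= `|c| *: x by rewrite rscale_ge0.
split; rewrite ?riesz_addr_ge0 // => a a0.
have [[tl tr] _ _] := tens_bi; have [[ml mr] _ _] := mul_bi.
apply: le_trans (rabsD _ _) _.
have le1 : rabs (c *: f a) <= tens (mul a (`|c| *: x)) (y + y').
  rewrite rabsZ; apply: (@le_trans _ _ (tens (mul a (`|c| *: x)) y)).
    rewrite (linZ (mr a)) (linZ (tl y)).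
    by apply: riesz_scale_le; rewrite ?fd.
  apply: (bimorphism_le tens_bi); rewrite ?riesz_lerDl //.
  exact: bimorphism_ge0 mul_bi _ _ a0 cx0.
have le2 : rabs (g a) <= tens (mul a x') (y + y').
  apply: le_trans (gd _ a0) _; apply: (bimorphism_le tens_bi) => //.
    exact: bimorphism_ge0 mul_bi _ _ a0 x'0.
  by rewrite addrC riesz_lerDl.
by rewrite (linD (mr a)) (linD (tl _)) riesz_leD.
Qed.

Lemma tensor_dominated_solid f g : tensor_dominated f -> linear g ->
    (forall a, 0 <= a -> rabs (g a) <= rabs (f a)) ->
  tensor_dominated g.
Proof.
move=> [_ [x [y [x0 y0 fd]]]] lg gf; split=> //; exists x, y; split=> // a a0.
exact: le_trans (gf a a0) (fd a a0).
Qed.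

Let T_arch : archimedean T. Proof. by case: tensP. Qed.

Definition tensor_dominated_class : opclass A T :=
  OpClass T_arch (fun f (h : tensor_dominated f) => h.1)
    tensor_dominated_bounded tensor_dominated_disjoint tensor_dominated0
    tensor_dominated_comb tensor_dominated_solid.

Lemma left_mul_dominated x y : tensor_dominated (fun a => tens (mul a x) y).
Proof.
have [[tl tr] _ _] := tens_bi; have [[ml mr] _ mhr] := mul_bi; split.
  exact: comp_linear (tl y) (ml x).
exists (rabs x), (rabs y); split; rewrite ?rabs_ge0 // => a a0.
by rewrite (mhr a a0).2; apply: bimorphism_abs_le.
Qed.

Let left_mul x y : op tensor_dominated_class :=
  @Op _ _ _ tensor_dominated_class _ (left_mul_dominated x y).

Lemma left_mul_bimorphism : riesz_bimorphism left_mul.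
Proof.
have [[tl tr] thl thr] := tens_bi; have [[ml mr] mhl mhr] := mul_bi.
have ll y : linear (left_mul^~ y).
  move=> c u v; apply: op_eq => a _.
  by rewrite op_addE op_scaleE /= mr tl.
have lr x : linear (left_mul x).
  move=> c u v; apply: op_eq => a _.
  by rewrite op_addE op_scaleE /= tr.
split=> [//|y y0|x x0]; split=> // u;
  apply: op_eq => a a0; rewrite op_rabsE //=.
- by rewrite (mhr a a0).2 (thl y y0).2.
- by rewrite (thr _ (bimorphism_ge0 mul_bi a0 x0)).2.
Qed.

(** The induced [Psi] maps [T] to operators on [A], and [M] swaps its arguments. [M] is a Riesz
    homomorphism in [a] because positive operators of the class are, and in [u] because evaluation
    at a positive [a] is. *)
Lemma left_action : exists M : A -> T -> T,
  riesz_bimorphism M /\ forall a x y, M a (tens x y) = tens (mul a x) y.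
Proof.
have [_ _ univ] := tensP.
have [Psi [[PsiH PsiE] _]] :=
  univ _ (@op_archimedean _ _ _ tensor_dominated_class) _ left_mul_bimorphism.
exists (fun a u => Psi u a); split; last by move=> a x y; rewrite PsiE.
have [Psil Psia] := PsiH; split; first split.
- by move=> u; apply: op_linear.
- by move=> a c u v; rewrite Psil.
- by move=> u u0; apply: op_ge0_riesz_hom; apply: riesz_hom_ge0 PsiH _ u0.
- move=> a a0; split=> [c u v|u]; first by rewrite Psil.
  by rewrite Psia op_rabsE.
Qed.

(* [n M_a u <= n^2 u + M_(a^2) u] *)
Lemma left_action_orthomorphism (M : A -> T -> T) (e : A) :
    left_id e mul -> right_id e mul -> riesz_bimorphism M ->
    (forall a x y, M a (tens x y) = tens (mul a x) y) ->
  forall a u v, 0 <= a -> rmeet u v = 0 -> rmeet (M a u) v = 0.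
Proof.
move=> e1 e2 Mb ME a u v a0 uv; have [[Ml Mr] Mhl Mhr] := Mb.
have [u0 v0] := (rmeet0_ge0l uv, rmeet0_ge0r uv).
have aa0 := falg_sqr_ge0 mulP a.
have e0 : 0 <= e by rewrite -(e1 e) falg_sqr_ge0.
have Me w : M e w = w.
  apply: (tensor_hom_eq tensP T_arch (Mhr e e0) (@riesz_hom_id _ _)).
  by move=> x y _ _; rewrite ME e1.
apply: (T_arch (y := M (mul a a) u)) => [||n].
- by rewrite rle_meet ?(bimorphism_ge0 Mb).
- exact: bimorphism_ge0.
have le1 : M a u *+ n <= u *+ n *+ n + M (mul a a) u.
  have := riesz_hom_le (Mhl u u0) (falg_mulrn_le mulP n e1 e2 a0).
  by rewrite (linD (Ml u)) !(linMn (Ml u)) Me.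
have vn0 := riesz_mulrn_ge0 n v0.
(* The multiple [u *+ n *+ n] is disjoint from [v *+ n], so only the term [M (mul a a) u], which is
   independent of [n], survives in the meet. *)
apply: (@le_trans _ _ (rmeet (u *+ n *+ n + M (mul a a) u) (v *+ n))).
  apply: rle_meet; last by rewrite riesz_mulrn_le ?rmeet_ler.
  by apply: le_trans le1; rewrite riesz_mulrn_le ?rmeet_lel.
apply: le_trans (rmeetDl_le _ _ _) _;
  rewrite ?riesz_mulrn_ge0 ?(bimorphism_ge0 Mb) //.
rewrite [X in X + _](_ : _ = 0) ?add0r ?rmeet_lel //.
by do 2 apply: rmeet0Mn; rewrite rmeetC; apply: rmeet0Mn; rewrite rmeetC.
Qed.

End LeftAction.

(** * Orthomorphisms as an operator class *)

Section Orthomorphisms.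
Variables (R : realType) (T : rieszType R).

(** Comparing [f u] with a fixed [v], rather than with [f v], is what makes the condition stable
    under sums. *)
Definition orthomorphism (f : T -> T) :=
  [/\ linear f, order_bounded f
    & forall u v, rmeet u v = 0 -> rmeet (rabs (f u)) v = 0].

Lemma orth_disjoint f : orthomorphism f -> disjointness_preserving f.
Proof. by move=> [_ _ fo] u v uv; rewrite fo // rmeetC fo // rmeetC. Qed.

Lemma orth0 : orthomorphism (fun=> 0).
Proof.
split=> [c u v|c|u v uv]; first by rewrite scaler0 addr0.
- by exists 0 => u _; rewrite rabs0.
- have [u0 v0] := (rmeet0_ge0l uv, rmeet0_ge0r uv).
  by rewrite rabs0; apply: rmeet0_le uv.
Qed.

Lemma orth_comb (c : R) f g : orthomorphism f -> orthomorphism g ->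
  orthomorphism (fun u => c *: f u + g u).
Proof.
move=> [lf bf of_] [lg bg og]; split=> [d u v|d|u v uv].
- by rewrite lf lg !scalerDr !scalerA [c * d]mulrC addrACA.
- have [h hP] := bf d; have [k kP] := bg d; exists (`|c| *: h + k) => u ud.
  apply: le_trans (rabsD _ _) _; rewrite rabsZ riesz_leD ?kP //.
  by rewrite riesz_scale_le ?hP.
- have h : rmeet (`|c| *: rabs (f u) + rabs (g u)) v = 0.
    by apply: rmeet0D; [apply: rmeet0Z => //; exact: of_|exact: og].
  apply: rmeet0_le h; rewrite ?rabs_ge0 ?(rmeet0_ge0r uv) //.
  by apply: le_trans (rabsD _ _) _; rewrite rabsZ.
Qed.

Lemma orth_solid f g : orthomorphism f -> linear g ->
  (forall u, 0 <= u -> rabs (g u) <= rabs (f u)) -> orthomorphism g.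
Proof.
move=> [lf bf of_] lg gf; split=> // [d|u v uv].
(* Domination is known on positive elements only, so the positive and negative parts of [u] each
   contribute one [h]. *)
- have [h hP] := bf d; exists (h + h) => u ud.
  apply: le_trans (lin_abs_le lg u) _.
  have gpos w : rabs w <= d -> rabs (g (rpos w)) <= h.
    move=> wd; apply: le_trans (gf _ (rpos_ge0 w)) (hP _ _).
    rewrite rabs_id ?rpos_ge0 //; apply: le_trans wd.
    by rewrite rjoin_le ?rle_abs ?rabs_ge0.
  by apply: riesz_leD; apply: gpos; rewrite ?rabsN.
- apply: rmeet0_le (of_ _ _ uv); rewrite ?rabs_ge0 ?(rmeet0_ge0r uv) //.
  exact: gf (rmeet0_ge0l uv).
Qed.

Definition orth_class (T_arch : archimedean T) : opclass T T :=
  OpClass T_arch (fun f (h : orthomorphism f) => let: And3 l _ _ := h in l)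
    (fun f (h : orthomorphism f) => let: And3 _ b _ := h in b)
    orth_disjoint orth0 orth_comb orth_solid.

End Orthomorphisms.

(** * The f-algebra structure on the tensor product *)

Section TensorFAlgebra.
Variables (R : realType) (A B T : rieszType R) (tens : A -> B -> T).
Variables (mulA : A -> A -> A) (mulB : B -> B -> B) (eA : A) (eB : B).
Hypothesis tensP : riesz_tensor_product tens.
Hypothesis mulAP : f_algebra mulA.
Hypothesis mulBP : f_algebra mulB.
Hypothesis eA1 : left_id eA mulA.
Hypothesis eA2 : right_id eA mulA.
Hypothesis eB1 : left_id eB mulB.
Hypothesis eB2 : right_id eB mulB.

Let T_arch : archimedean T. Proof. by case: tensP. Qed.

Let tens_bi : riesz_bimorphism tens. Proof. by case: tensP. Qed.

Let mulA_bi : riesz_bimorphism mulA. Proof. exact: falg_bimorphism. Qed.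

Let mulB_bi : riesz_bimorphism mulB. Proof. exact: falg_bimorphism. Qed.

Let OT : opclass T T := orth_class T_arch.

(* The product is [mul u v = L u v], where [L] is induced by the bimorphism
   [(a, b) |-> M a \o N b] into the orthomorphisms of [T]. *)
Lemma tensor_regular_representation : exists L : T -> op OT,
  riesz_hom L /\ forall a b x y,
    L (tens a b) (tens x y) = tens (mulA a x) (mulB b y).
Proof.
have flipP := tensor_flip tensP.
have [M [Mb ME]] := left_action tensP mulAP.
have [N [Nb NE]] := left_action flipP mulBP.
have Mo := left_action_orthomorphism tensP mulAP eA1 eA2 Mb ME.
have No := left_action_orthomorphism flipP mulBP eB1 eB2 Nb NE.
have [[Ml Mr] Mhl Mhr] := Mb; have [[Nl Nr] Nhl Nhr] := Nb.
have MNle a b u : rabs (M a (N b u)) <= M (rabs a) (N (rabs b) (rabs u)).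
  apply: le_trans (bimorphism_abs_le Mb _ _) _.
  by apply: (bimorphism_le Mb); rewrite ?rabs_ge0 ?bimorphism_abs_le.
(* [N (rabs b)] and then [M (rabs a)] keep a positive element disjoint from [v], and their composite
   dominates the operator. *)
have MNo a b : orthomorphism (fun u => M a (N b u)).
  split=> [|d|u v uv]; first exact: comp_linear (Mr a) (Nr b).
    exists (M (rabs a) (N (rabs b) d)) => u ud; apply: le_trans (MNle _ _ _) _.
    apply: (bimorphism_le Mb); rewrite ?(bimorphism_ge0 Nb) ?rabs_ge0 //.
    by apply: (bimorphism_le Nb); rewrite ?rabs_ge0.
  have [u0 v0] := (rmeet0_ge0l uv, rmeet0_ge0r uv).
  have h : rmeet (M (rabs a) (N (rabs b) u)) v = 0.
    by apply: Mo; [|apply: No]; rewrite ?rabs_ge0.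
  by apply: rmeet0_le h; rewrite ?rabs_ge0 // -{2}(rabs_id u0).
pose phi a b : op OT := @Op _ _ _ OT _ (MNo a b).
have phib : riesz_bimorphism phi.
  split; first split.
  - by move=> b c a a'; apply: op_eq => u _; rewrite op_addE op_scaleE /= Ml.
  - by move=> a c b b'; apply: op_eq => u _; rewrite op_addE op_scaleE /= Nl Mr.
  - move=> b b0; split.
      by move=> c a a'; apply: op_eq => u _; rewrite op_addE op_scaleE /= Ml.
    move=> a; apply: op_eq => u u0; rewrite op_rabsE //=.
    by rewrite (Mhl _ (bimorphism_ge0 Nb b0 u0)).2.
  - move=> a a0; split.
      by move=> c b b'; apply: op_eq => u _; rewrite op_addE op_scaleE /= Nl Mr.
    move=> b; apply: op_eq => u u0; rewrite op_rabsE //=.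
    by rewrite (Nhl u u0).2 (Mhr a a0).2.
have [_ _ univ] := tensP.
have [L [[Lh LE] _]] := univ _ (@op_archimedean _ _ _ OT) _ phib.
by exists L; split=> // a b x y; rewrite LE /= NE ME.
Qed.

Lemma tensor_f_algebra : exists mul : T -> T -> T,
  [/\ forall a b x y,
        mul (tens a b) (tens x y) = tens (mulA a x) (mulB b y),
      f_algebra mul, left_id (tens eA eB) mul & right_id (tens eA eB) mul].
Proof.
have [L [Lh LE]] := tensor_regular_representation.
pose mul u v := L u v; exists mul.
have [Ll La] := Lh.
(* In the first variable [mul] is [L] followed by evaluation at a positive point; in the second it
   is the positive operator [L u]. *)
have mulb : riesz_bimorphism mul.
  split; first split.
  - by move=> v c u u'; rewrite /mul Ll.
  - by move=> u; apply: op_linear.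
  - move=> v v0; exact: riesz_hom_comp (op_eval_riesz_hom OT v0) Lh.
  - by move=> u u0; apply: op_ge0_riesz_hom; apply: riesz_hom_ge0 Lh _ u0.
have [[ml mr] mhl mhr] := mulb.
(* Both units are squares, hence positive. *)
have e0 : 0 <= tens eA eB.
  by rewrite (bimorphism_ge0 tens_bi) // -1?(eA1 eA) -1?(eB1 eB) falg_sqr_ge0.
have mul1 : left_id (tens eA eB) mul.
  apply: (tensor_hom_eq tensP T_arch (mhr _ e0) (@riesz_hom_id _ _)).
  by move=> x y _ _; rewrite /mul LE eA1 eB1.
have mul2 : right_id (tens eA eB) mul.
  apply: (tensor_hom_eq tensP T_arch (mhl _ e0) (@riesz_hom_id _ _)).
  by move=> x y _ _; rewrite /mul LE eA2 eB2.
have mul_assoc : associative mul.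
  (* With [w] positive and fixed, both sides are bimorphisms in [(u, v)], which reduces [u] and [v]
     to positive tensors. Both sides are then Riesz homomorphisms in [w], and [w] is reduced to a
     tensor as well. *)
  suff : forall w, 0 <= w ->
      (fun u v => mul u (mul v w)) =2 (fun u v => mul (mul u v) w).
    move=> h u v w.
    apply: (lin_eq (comp_linear (mr u) (mr v)) (mr (mul u v)) _ w) => w' w0.
    exact: h w' w0 u v.
  move=> w w0; apply: (tensor_bimorphism_eq tensP T_arch).
  - exact: (bimorphism_comp2 (@riesz_hom_id _ _) (mhl w w0) mulb).
  - exact: (bimorphism_comp (mhl w w0) mulb).
  move=> a b x y a0 b0 x0 y0.
  have ab0 := bimorphism_ge0 tens_bi a0 b0.
  have xy0 := bimorphism_ge0 tens_bi x0 y0.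
  have h1 := riesz_hom_comp (mhr _ ab0) (mhr _ xy0).
  have h2 := mhr _ (bimorphism_ge0 mulb ab0 xy0).
  apply: (tensor_hom_eq tensP T_arch h1 h2 _ w).
  move=> s t _ _; rewrite /= /mul !LE.
  have [[_ -> _] _] := mulAP; by have [[_ -> _] _] := mulBP.
split=> //; split; first by split=> // u v; apply: bimorphism_ge0.
move=> u v w uv w0.
have [u0 v0] := (rmeet0_ge0l uv, rmeet0_ge0r uv).
split.
  (* [L u] and [L v] are disjoint operators, so their values at [w + tens eA eB] are disjoint. These
     values dominate [mul u w] and [v] respectively, the latter being [v] times the unit. *)
  have Luv : rmeet (L u) (L v) = 0 by apply: riesz_hom_disjoint Lh _ _ uv.
  have we0 : 0 <= w + tens eA eB by rewrite riesz_addr_ge0.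
  have h : rmeet (mul u (w + tens eA eB)) (mul v (w + tens eA eB)) = 0.
    by rewrite /mul -op_rmeetE // Luv.
  rewrite -{1}(mul2 v); apply: rmeet0_le h; rewrite ?(bimorphism_ge0 mulb) //.
    by apply: (bimorphism_le mulb); rewrite ?riesz_lerDl.
  by apply: (bimorphism_le mulb); rewrite // addrC riesz_lerDl.
(* Left multiplication by [w] is the orthomorphism [L w]. *)
have [_ _ Lo] := op_mem (L w).
by have := Lo _ _ uv; rewrite rabs_id // (bimorphism_ge0 mulb).
Qed.

End TensorFAlgebra.

Theorem theorem5p4 (R : realType) (A B T : rieszType R)
    (mulA : A -> A -> A) (mulB : B -> B -> B) (eA : A) (eB : B)
    (tens : A -> B -> T) :
  archimedean A -> f_algebra mulA -> left_id eA mulA -> right_id eA mulA ->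
  archimedean B -> f_algebra mulB -> left_id eB mulB -> right_id eB mulB ->
  riesz_tensor_product tens ->
  exists mul : T -> T -> T,
    [/\ extends_canonical_mul tens mulA mulB mul,
        f_algebra mul,
        exists e : T, left_id e mul /\ right_id e mul
      & forall (C : rieszType R) (mulC : C -> C -> C),
          archimedean C -> f_algebra mulC ->
          forall psi : A -> B -> C,
            riesz_bimorphism psi ->
            multiplicative_bilinear mulA mulB mulC psi ->
            exists! h : T -> C,
              [/\ algebra_hom mul mulC h,
                  riesz_hom h
                & forall (f : A) (g : B), h (tens f g) = psi f g]].
Proof.
move=> _ mulAP eA1 eA2 _ mulBP eB1 eB2 tensP.
have [mul [mulE mulP e1 e2]] :=
  tensor_f_algebra tensP mulAP mulBP eA1 eA2 eB1 eB2.
have mulb := falg_bimorphism mulP; have [[ml mr] _ _] := mulb.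
exists mul; split=> //; last 2 first.
- by exists (tens eA eB).
- move=> C mulC Ca mulCP psi psib psiM.
  have mulCb := falg_bimorphism mulCP.
  have [_ _ univ] := tensP.
  have [h [[hh hE] hu]] := univ C Ca psi psib.
  (* Uniqueness already holds among Riesz homomorphisms. Multiplicativity of [h] is an equality of
     two bimorphisms on [T], checked on tensors. *)
  exists h; split; last by move=> g [_ gh gE]; apply: hu.
  split=> //; split; first by case: hh.
  apply: (tensor_bimorphism_eq tensP Ca).
  + exact: (bimorphism_comp hh mulb).
  + exact: (bimorphism_comp2 hh hh mulCb).
  by move=> x y x' y' _ _ _ _; rewrite mulE !hE psiM.
move=> s t; rewrite /tensor_sum.
have sumE (f : T -> T) r : linear f ->
    f (\sum_(p <- r) tens p.1 p.2) = \sum_(p <- r) f (tens p.1 p.2).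
  by move=> lf; apply: big_morph; [apply: linD|apply: lin0].
rewrite (sumE (mul^~ _) s (ml _)); apply: eq_bigr => p _.
by rewrite (sumE _ t (mr _)); apply: eq_bigr => q _.
Qed.
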